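(* Consider the Gambler's ruin model with win probability $b\in[0,1]$, $b>1/2$ (loss probability $1-b<1/2$), and let $r\in\{1,2,\dots\}$. Then for every $u\in\mathbb{N}$ the infinite-time Parisian ruin probability is $$\psi^*_r(u)=\frac{1-bC_1}{1-(1-b)C_1}\left(\frac{1-b}{b}\right)^{u+1},$$ where $$C_1=\sum_{n=1}^{r}p_{n-1}^{*(n-1)}-\sum_{n=1}^{r}\sum_{i=2}^{n-1}\frac{1}{n-i}\,p_{n-1-i}^{*(n-i)}\,p_i^{*(i-1)},$$ and sums whose upper limit is smaller than the lower limit are zero.
   Context: $\mathbb{N}=\{0,1,2,\dots\}$. Gambler's ruin model: $Y_1,Y_2,\dots$ are i.i.d. with p.m.f. $p_k=\mathbb{P}(Y_1=k)$ given by $p_0=1-b$, $p_2=b$ and $p_k=0$ for all other $k$. Put $X_n=\sum_{i=1}^nY_i$, $X_0=0$. The process with initial value $u\in\mathbb{N}$ is $R^*_n=u-n+X_n$, $n\in\mathbb{N}$, and $\mathbb{P}_u$ denotes probability given $R^*_0=u$. Convolutions: $p^{*n}_k=\mathbb{P}(Y_1+\dots+Y_n=k)$, with $p^{*0}_k=1$ if $k=0$ and $0$ otherwise. Parisian ruin time, for a fixed integer $r\ge1$ and starting value $u\in\mathbb{N}$: $$\tau^r=\inf\{n\in\mathbb{N}: n-\sup\{s<n:R^*_s=-1,\,R^*_{s-1}=0\}=r,\ R^*_n<0\}$$ (with $\sup\emptyset=-\infty$, $\inf\emptyset=\infty$). Infinite-time Parisian ruin probability: $\psi^*_r(u)=\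lim_{t\to\infty}\mathbb{P}_u(\tau^r<t)$.
   Formalization: In the ruin time the supremum is over s ≤ n instead of s < n: with s < n the formula fails for even r (for r = 2, path 0, −1, 0, −1 counts as ruin, so ψ(0) ≠ ((1−b)/b)² for 1/2 < b < 1). For odd r the two definitions agree. *)

(* Defs.v *)
From HB Require Import structures.
From mathcomp Require Import all_boot all_order all_algebra.
From mathcomp Require Import all_classical all_reals all_analysis.

Set Implicit Arguments.
Unset Strict Implicit.
Unset Printing Implicit Defensive.

Import Order.TTheory GRing.Theory Num.Theory.
Import numFieldNormedType.Exports.

Local Open Scope classical_set_scope.
Local Open Scope ring_scope.

Definition mutually_independent (d d' : measure_display)
    (T : measurableType d) (T' : measurableType d') (R : realType)
    (P : probability T R) (Y : nat -> {RV P >-> T'}) : Prop :=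
  forall (J : seq nat) (A : nat -> set T'),
    uniq J -> (forall j, measurable (A j)) ->
    P (\bigcap_(j in [set` J]) (Y j @^-1` A j)) =
      (\prod_(j <- J) P (Y j @^-1` A j))%E.

Definition gambler_pmf (R : realType) (b : R) (k : nat) : R :=
  if k == 0%N then 1 - b else if k == 2%N then b else 0.

(* [Y i] is the claim usually written Y_(i+1). *)
Definition gambler_claims (d : measure_display) (T : measurableType d)
    (R : realType) (P : probability T R) (b : R)
    (Y : nat -> {RV P >-> nat}) : Prop :=
  mutually_independent Y /\
  forall i k, P (Y i @^-1` [set k]) = (gambler_pmf b k)%:E.

Section RiskProcess.
Context (d : measure_display) (T : measurableType d) (R : realType).
Context (P : probability T R) (Y : nat -> {RV P >-> nat}).

Definition partial_sum (n : nat) (w : T) : nat := (\sum_(i < n) Y i w)%N.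

Definition conv_pmf (n k : nat) : R :=
  fine (P [set w | partial_sum n w = k]).

Definition risk_process (u n : nat) (w : T) : int :=
  u%:Z - n%:Z + (partial_sum n w)%:Z.

(* Times [s <= n] at which the process enters the negative half-line.  The
   bound is [s <= n]: with [s < n] a time [n] at which the process re-enters
   at -1, exactly [r] steps after its previous entrance, would count as ruin
   although it was nonnegative in between (path 0, -1, 0, -1 with [r = 2]). *)
Definition entrance_times (u n : nat) (w : T) : set nat :=
  [set s | [/\ (0 < s <= n)%N, risk_process u s w = -1
              & risk_process u s.-1 w = 0]].

(* In the extended reals, [ereal_sup set0 = -oo] and [ereal_inf set0 = +oo]. *)
Definition last_entrance (u n : nat) (w : T) : \bar R :=
  ereal_sup [set (s%:R : R)%:E | s in entrance_times u n w].

Definition parisian_time (r u : nat) (w : T) : \bar R :=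
  ereal_inf [set (n%:R : R)%:E | n in
    [set n : nat | ((n%:R : R)%:E - last_entrance u n w)%E = (r%:R : R)%:E /\
                   risk_process u n w < 0]].

Definition parisian_ruin_before (r u t : nat) : \bar R :=
  P [set w | (parisian_time r u w < (t%:R : R)%:E)%E].

Definition parisian_ruin_prob (r u : nat) : \bar R :=
  lim (parisian_ruin_before r u t @[t --> \oo]).

Definition C1 (r : nat) : R :=
  \sum_(1 <= n < r.+1) conv_pmf n.-1 n.-1
  - \sum_(1 <= n < r.+1) \sum_(2 <= i < n)
      ((n - i)%N%:R)^-1 * conv_pmf (n - i) (n - 1 - i) * conv_pmf i.-1 i.

Lemma measurable_claims (s : seq nat) :
  measurable [set w | forall i, (i < size s)%N -> Y i w = nth 0%N s i].
Proof.
rewrite (_ : [set _ | _] =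
  \bigcap_i (if (i < size s)%N then Y i @^-1` [set nth 0%N s i] else setT)).
  apply: bigcapT_measurable => i; case: ifP => // _.
  by rewrite -[X in measurable X]setTI; exact: measurable_funP.
apply/seteqP; split => w /= H i.
  by move=> _; case: ifP => // /H.
by move=> si; have := H i I; rewrite si.
Qed.

Lemma measurable_before (r u t : nat) :
  measurable [set w | (parisian_time r u w < (t%:R : R)%:E)%E].
Proof.
set E := [set w | _].
have psE (w w' : T) : (forall i, (i < t)%N -> Y i w = Y i w') ->
    forall n, (n <= t)%N -> risk_process u n w = risk_process u n w'.
  move=> ww' n nt; rewrite /risk_process /partial_sum.
  by congr (_ + Posz _); apply: eq_bigr => i _; apply: ww'; exact: leq_trans nt.
have Edep (w w' : T) : (forall i, (i < t)%N -> Y i w = Y i w') -> E w -> E w'.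
  move=> ww'; have rE := psE _ _ ww'.
  rewrite /E /= /parisian_time => /ereal_inf_lt[_ [n [nr n0] <-] nt].
  have ltnt : (n < t)%N by move: nt; rewrite lte_fin ltr_nat.
  apply: le_lt_trans nt; apply: ereal_inf_lbound; exists n => //; split.
    rewrite -nr /last_entrance; congr (_ - ereal_sup _)%E.
    have sle s : (0 < s <= n)%N -> (s <= t)%N /\ (s.-1 <= t)%N.
      move=> /andP[_ sn]; have st : (s <= t)%N := leq_trans sn (ltnW ltnt).
      by split=> //; exact: leq_trans (leq_pred _) st.
    congr (image _ _); apply/seteqP; split => s /= [sn s1 s2].
      have [st st1] := sle _ sn.
      by split; [by []|rewrite (rE s st)|rewrite (rE _ st1)].
    have [st st1] := sle _ sn.
    by split; [by []|rewrite -(rE s st)|rewrite -(rE _ st1)].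
  by rewrite -(rE n (ltnW ltnt)).
pose F (s : seq nat) : set T :=
  [set w | forall i, (i < size s)%N -> Y i w = nth 0%N s i].
pose G (k : nat) : set T := if unpickle k is Some s then
  (if `[< size s = t /\ F s `<=` E >] then F s else set0) else set0.
rewrite (_ : E = \bigcup_k G k).
  apply: bigcupT_measurable => k; rewrite /G; case: unpickle => // s.
  by case: ifP => // _; exact: measurable_claims.
apply/seteqP; split => w.
  move=> Ew; pose s := mkseq (fun i => Y i w) t.
  have Fw : F s w by move=> i; rewrite size_mkseq => it; rewrite nth_mkseq.
  exists (pickle s) => //; rewrite /G pickleK.
  case: asboolP => // -[]; split; first by rewrite size_mkseq.
  move=> w' Fw'; apply: (Edep w) => // i it.
  by rewrite Fw ?size_mkseq// Fw' ?size_mkseq.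
move=> [k _]; rewrite /G; case: unpickle => // s.
by case: asboolP => // -[_ FE] /FE.
Qed.

Lemma parisian_ruin_prob_cvg (r u : nat) :
  parisian_ruin_before r u t @[t --> \oo] --> parisian_ruin_prob r u.
Proof.
apply: ereal_nondecreasing_is_cvgn => m n mn; apply: le_measure.
- by rewrite inE; exact: measurable_before.
- by rewrite inE; exact: measurable_before.
- by move=> w /= /lt_le_trans; apply; rewrite lee_fin ler_nat.
Qed.

End RiskProcess.

(* Main.v *)
(* Before ruin the process is described by its position and, below zero, by the
   number of steps left. Let F be the probability of climbing from -1 to 0
   within r steps, and rho = (1 - b) / b. The ruin probability is harmonic and
   vanishes at infinity, so from u it is rho^(u+1) times the ruin probability p
   of a process that has just entered -1; and p = 1 - F + F rho p by
   restarting at 0.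
   It remains to see F = b C1: the n-th term of C1 is the probability that the
   process goes from -1 back to -1 in n - 1 steps while staying negative, the
   paths that do not stay negative being subtracted from all of them. Both
   sides are ballot numbers, and the double sum is a first-passage convolution
   with binomial coefficients. *)
Require Import Defs.
From HB Require Import structures.
From mathcomp Require Import all_boot all_order all_algebra.
From mathcomp Require Import ring lra zify.
From mathcomp Require Import all_classical all_reals all_analysis.

Set Implicit Arguments.
Unset Strict Implicit.
Unset Printing Implicit Defensive.

Import Order.TTheory GRing.Theory Num.Theory.
Import numFieldNormedType.Exports.

Local Open Scope classical_set_scope.
Local Open Scope ring_scope.

(** * Ballot numbers and binomial coefficients *)

(* Number of paths that reach height [y] for the first time at their last step,
   with [m] down-steps. *)
Fixpoint ballot (m : nat) : nat -> nat :=
  if m is m'.+1 then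
    fix bal (y : nat) : nat :=
      if y is y'.+1 then (bal y' + ballot m' y'.+2)%N else 0%N
  else fun=> 1%N.

Lemma ballotSS m y : ballot m.+1 y.+1 = (ballot m.+1 y + ballot m y.+2)%N.
Proof. by []. Qed.

Lemma bin_double_mid n : 'C(n.*2.+1, n.+1) = 'C(n.*2.+1, n).
Proof. by rewrite -bin_sub; [congr 'C(_, _); lia | lia]. Qed.

(** Reflection principle, written without subtraction: before its final up-step the path ends at
    [y], and reflecting the paths that already touched [y + 1] leaves one down-step fewer. *)
Lemma ballot_bin m y :
  (ballot m y.+1 + (if m is m'.+1 then 'C(y + m.*2, m') else 0) =
   'C(y + m.*2, m))%N.
Proof.
elim: m y => [|m IHm] y; first by rewrite bin0.
elim: y => [|y IHy].
  rewrite ballotSS [ballot _ 0]/= !add0n doubleS binS bin_double_mid.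
  have := IHm 1%N; rewrite add1n; case: m {IHm} => [|m] /=.
    by rewrite !bin0.
  by rewrite (binS _.+1 m); lia.
rewrite ballotSS addSn binS; have := IHm y.+2.
rewrite (_ : (y.+2 + m.*2 = y + m.+1.*2)%N); last by lia.
case: m {IHm} IHy => [|m] IHy IHm; first by rewrite !bin0 in IHy IHm *; lia.
by rewrite (binS _ m); lia.
Qed.

(** These are the Catalan numbers; the identity accounts for the factor 1/(n-i) in [C1]. *)
Lemma ballot1_bin m : (m.*2.+1 * ballot m 1 = 'C(m.*2.+1, m))%N.
Proof.
have := ballot_bin m 0; rewrite add0n.
case: m => [|m] E; first by rewrite !bin0.
have E1 := mul_bin_diag m.+1.*2.+1 m.
have E2 := mul_bin_down m.+1.*2.+1 m.+1.
apply/eqP; rewrite -(eqn_add2r (m.+1.*2.+1 * 'C(m.+1.*2, m))) -mulnDr E E1 E2.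
by rewrite -mulSn; apply/eqP; congr (_ * _)%N; lia.
Qed.

(* First-passage decomposition: a path with [m] down-steps that ends at height
   [a + y] passes through [y], for the first time at step [y + k.*2]. *)
Lemma ballot_conv a m y :
  (\sum_(k < m.+1) ballot k y * 'C((m - k).*2 + a, m - k) =
   'C(m.*2 + a + y, m))%N.
Proof.
elim: m y => [|m IHm] y.
  by rewrite big_ord_recr big_ord0 /= subn0 !bin0.
elim: y => [|y IHy].
  rewrite big_ord_recl mul1n subn0 big1 ?addn0 //.
(* Pascal's rule mirrors the recurrence of [ballot]: what remains to climb is [y], or [y + 2] after
   using up a down-step. *)
rewrite addnS binS -IHy (_ : (m.+1.*2 + a + y = m.*2 + a + y.+2)%N); last by lia.
rewrite -IHm big_ord_recl [in RHS]big_ord_recl -addnA; congr (_ + _)%N.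
rewrite -big_split; apply: eq_bigr => i _.
by rewrite lift0 ballotSS subSS mulnDl.
Qed.

(** * First-passage probabilities and the terms of [C1] *)

Section Hitting.
Context (R : realType) (b : R).
Implicit Types (n m y c i : nat).

(* Probability of climbing [y] units for the first time at step [n]. *)
Fixpoint hit (n y : nat) : R :=
  match n, y with
  | 0%N, _ => (y == 0%N)%:R
  | n'.+1, 0%N => 0
  | n'.+1, y'.+1 => b * hit n' y' + (1 - b) * hit n' y'.+2
  end.

Lemma hit_lt n y : (n < y)%N -> hit n y = 0.
Proof.
elim: n y => [|n IH] [|y] //= ny.
by rewrite !IH ?mulr0 ?addr0//; lia.
Qed.

Lemma hit_odd n y : odd (n + y) -> hit n y = 0.
Proof.
elim: n y => [|n IH] [|y] //= ny.
rewrite !IH ?mulr0 ?addr0//; first by move: ny; rewrite !addnS /= !negbK.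
by move: ny; rewrite !addnS /= negbK.
Qed.

(** Every path counted has [y + m] wins and [m] losses, hence the same weight. *)
Lemma hitE m y : hit (y + m.*2) y = (ballot m y)%:R * b ^+ (y + m) * (1 - b) ^+ m.
Proof.
have [n] := ubnP (y + m.*2); elim: n m y => // n IH [|m] [|y] le_n.
- by rewrite /= expr0 !mulr1.
- rewrite /= addn0 (@hit_lt _ y.+2); last by lia.
  have := IH 0%N y; rewrite double0 !addn0 => ->; last by lia.
  by rewrite /= exprS !expr0; ring.
- by rewrite doubleS /= !mul0r.
rewrite [hit _ _]/= IH; last by lia.
rewrite (_ : (y + m.+1.*2 = y.+2 + m.*2)%N); last by lia.
rewrite IH; last by lia.
rewrite ballotSS natrD (_ : (y.+2 + m = y.+1 + m.+1)%N); last by lia.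
by rewrite (_ : (y.+1 + m.+1 = (y + m.+1).+1)%N) // !exprS; ring.
Qed.

Definition hit_within (c y : nat) : R := \sum_(n < c.+1) hit n y.

Lemma hit_within0 c : hit_within c 0 = 1.
Proof. by rewrite /hit_within big_ord_recl big1 ?addr0. Qed.

Lemma hit_withinS c y :
  hit_within c.+1 y.+1 = b * hit_within c y + (1 - b) * hit_within c y.+2.
Proof.
rewrite /hit_within big_ord_recl add0r !mulr_sumr -big_split.
by apply: eq_bigr.
Qed.

Lemma avg_itv (x y : R) : 0 <= b <= 1 -> 0 <= x <= 1 -> 0 <= y <= 1 ->
  0 <= b * x + (1 - b) * y <= 1.
Proof. nra. Qed.

Lemma hit_within_itv (b0 : 0 <= b) (b1 : b <= 1) c y :
  0 <= hit_within c y <= 1.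
Proof.
elim: c y => [|c IH] y.
  by rewrite /hit_within big_ord_recl big_ord0 addr0 ler0n lern1 leq_b1.
case: y => [|y]; first by rewrite hit_within0; lra.
by rewrite hit_withinS; apply: avg_itv => //; rewrite b0 b1.
Qed.

(** Binomial form of the n-fold convolution: claims are 0 or 2, so [k] is twice the number of
    wins. *)
Definition win_pmf (n k : nat) : R :=
  if odd k then 0 else 'C(n, k./2)%:R * b ^+ k./2 * (1 - b) ^+ (n - k./2).

Lemma win_pmf_double n j :
  win_pmf n j.*2 = 'C(n, j)%:R * b ^+ j * (1 - b) ^+ (n - j).
Proof. by rewrite /win_pmf odd_double doubleK. Qed.

Lemma sum_even (F : nat -> R) m :
  (forall i, odd i -> F i = 0) ->
  \sum_(2 <= i < m.*2.+1) F i = \sum_(j < m) F j.+1.*2.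
Proof.
move=> F0; elim: m => [|m IH]; first by rewrite big_ord0 big_geq.
rewrite doubleS big_nat_recr; last by lia.
rewrite big_ord_recr /= -IH; congr (_ + _).
case: m {IH} => [|m]; first by rewrite !big_geq.
rewrite big_nat_recr; last by lia.
have o : odd m.+1.*2.+1 by rewrite /= odd_double.
by rewrite (F0 _ o) /= addr0.
Qed.

(** The factor [b] is the final win, from -1 to 0. For n = 2m+1 both sides carry the weight
    b^{m+1}(1-b)^m, and the sum collapses to the subtracted binomial of [ballot_bin] at [y = 0]. *)
Lemma hit1_win_pmf n : (0 < n)%N ->
  hit n 1 = b * (win_pmf n.-1 n.-1 - \sum_(2 <= i < n)
    ((n - i)%N%:R)^-1 * win_pmf (n - i) (n - 1 - i) * win_pmf i.-1 i).
Proof.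
move=> n0; have [on|en] := boolP (odd n); last first.
  rewrite hit_odd; last by rewrite addn1 oddS.
  rewrite /win_pmf ifT; last by move: en; case: n n0 => //= n _; rewrite negbK.
  (* For even [n], one of [i] and [n - 1 - i] is odd, so each product vanishes. *)
  rewrite big_nat_cond big1 ?subr0 ?mulr0// => i /andP[/andP[i2 ilt] _].
  have [_|ei] := ifP; first by rewrite mulr0 mul0r.
  by rewrite ifT ?mulr0 ?mul0r//; lia.
have -> : n = (n./2).*2.+1 by lia.
move: (n./2) => m {n n0 on}; rewrite -add1n hitE add1n /=.
rewrite win_pmf_double sum_even; last first.
  by move=> i oi; rewrite /win_pmf oi mulr0.
(* By [ballot1_bin] the inverse turns the first binomial into a ballot number; the powers multiply
   to a weight independent of [j]. *)
have -> : \sum_(j < m) (((m.*2.+1 - j.+1.*2)%N%:R)^-1 *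
    win_pmf (m.*2.+1 - j.+1.*2) (m.*2.+1 - 1 - j.+1.*2) *
    win_pmf j.+1.*2.-1 j.+1.*2) =
  (\sum_(j < m) ballot (m - j.+1) 1 * 'C(j.*2.+1, j))%N%:R * b ^+ m * (1 - b) ^+ m.
  rewrite natr_sum !mulr_suml; apply: eq_bigr => -[j jm] _ /=.
  rewrite subn1 /= -doubleB.
  rewrite (_ : (m.*2.+1 - j.+1.*2)%N = (m - j.+1).*2.+1); last by lia.
  rewrite !win_pmf_double -ballot1_bin !natrM.
  rewrite bin_double_mid.
  have -> : ((m - j.+1).*2.+1 - (m - j.+1) = (m - j.+1).+1)%N by lia.
  have -> : ((j.*2).+1 - j.+1 = j)%N by lia.
  have em : b ^+ m = b ^+ (m - j.+1) * b ^+ j.+1.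
    by rewrite -exprD; congr (_ ^+ _); lia.
  have eq : (1 - b) ^+ m = (1 - b) ^+ (m - j.+1).+1 * (1 - b) ^+ j.
    by rewrite -exprD; congr (_ ^+ _); lia.
  rewrite em eq; field.
  by rewrite nat1r pnatr_eq0.
(* Reversing the summation gives [ballot_conv] with [a = y = 1]. *)
have -> : (\sum_(j < m) ballot (m - j.+1) 1 * 'C(j.*2.+1, j) =
    if m is m'.+1 then 'C(m.*2, m') else 0)%N.
  case: m => [|m]; first by rewrite big_ord0.
  have -> : m.+1.*2 = (m.*2 + 1 + 1)%N by lia.
  rewrite -(ballot_conv 1 m 1).
  rewrite (reindex_inj rev_ord_inj); apply: eq_bigr => -[i im] _ /=.
  by rewrite subSS subKn ?addn1//; lia.
have := ballot_bin m 0; rewrite add0n => <-.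
rewrite natrD (_ : (m.*2 - m = m)%N); last by lia.
by rewrite exprS; ring.
Qed.

End Hitting.

(** * The process as a chain with a clock *)

(* [Above x] is the position [x >= 0]. [Below y c] is the position [- (y + 1)]
   with [c] further steps to go before ruin, so that [Below y 0] is ruin. *)
Variant state := Above of nat | Below of nat & nat.

Definition ruined (st : state) : bool := if st is Below _ 0 then true else false.

(** Entering -1 loads the clock with [r]; reaching 0 on the last allowed step still avoids ruin.
    Ruin is absorbing, so the state at time [t] tells whether it has occurred by then. *)
Definition move (r : nat) (st : state) (win : bool) : state :=
  match st with
  | Above x =>
      if win then Above x.+1 else if x is x'.+1 then Above x' else Below 0 r
  | Below y 0 => Below y 0
  | Below y c.+1 =>
      if win then if y is y'.+1 then Below y' c else Above 0
      else Below y.+1 c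
  end.

(** * Ruin probability of the chain *)

Section RuinProbability.
Context (R : realType) (b : R) (r : nat).
Hypotheses (b_ge0 : 0 <= b) (b_le1 : b <= 1).
Implicit Types (t c y x u : nat) (st : state).

(** Conditioning on the first toss is built in, so one-step equations hold by computation. *)
Fixpoint coin_prob (n : nat) (Q : seq bool -> bool) : R :=
  if n is m.+1 then
    b * coin_prob m (fun s => Q (true :: s)) +
    (1 - b) * coin_prob m (fun s => Q (false :: s))
  else (Q [::])%:R.

Lemma coin_prob_itv n Q : 0 <= coin_prob n Q <= 1.
Proof.
elim: n Q => [|n IH] Q /=; first by rewrite ler0n lern1 leq_b1.
by apply: avg_itv => //; rewrite b_ge0.
Qed.

Lemma eq_coin_prob n (Q1 Q2 : seq bool -> bool) :
  Q1 =1 Q2 -> coin_prob n Q1 = coin_prob n Q2.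
Proof.
elim: n Q1 Q2 => [|n IH] Q1 Q2 /= Q12; first by rewrite Q12.
by congr (_ * _ + _ * _); apply: IH => s; exact: Q12.
Qed.

Lemma coin_prob_false n : coin_prob n (fun=> false) = 0.
Proof. by elim: n => //= n ->; rewrite !mulr0 addr0. Qed.

Lemma coin_prob_wins n k :
  coin_prob n (fun s => (count id s).*2 == k) = win_pmf b n k.
Proof.
have [ok|ek] := boolP (odd k).
  rewrite /win_pmf ok.
  rewrite -[RHS](coin_prob_false n); apply: eq_coin_prob => s.
  by apply/negP => /eqP ks; rewrite -ks odd_double in ok.
rewrite -(even_halfK ek); move: k./2 => j {k ek}; rewrite win_pmf_double.
elim: n j => [|n IH] j.
  rewrite /= sub0n; case: j => [|j] /=; first by rewrite !expr0 !mulr1.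
  by rewrite !mul0r.
rewrite [LHS]/= IH; case: j => [|j].
  rewrite (@eq_coin_prob n _ (fun=> false))//.
  by rewrite coin_prob_false !bin0 !subn0 !exprS; ring.
rewrite (@eq_coin_prob n _ (fun s => (count id s).*2 == j.*2)); last first.
  by move=> s /=; rewrite add1n doubleS.
rewrite IH binS natrD subSS exprS.
(* For [n <= j] the truncated exponent [n - j.+1] is harmless because its binomial is 0. *)
have [jn|nj] := ltnP j n; first by rewrite -(subnSK jn) exprS; ring.
by rewrite (@bin_small n j.+1) //; ring.
Qed.

Definition ruin_prob t st : R :=
  coin_prob t (fun s => ruined (foldl (move r) st s)).

Lemma ruin_prob_itv t st : 0 <= ruin_prob t st <= 1.
Proof. exact: coin_prob_itv. Qed.

Lemma ruin_probS t st :
  ruin_prob t.+1 st =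
    b * ruin_prob t (move r st true) + (1 - b) * ruin_prob t (move r st false).
Proof. by []. Qed.

Lemma ruin_prob_ruined t y : ruin_prob t (Below y 0) = 1.
Proof. by elim: t => [|t IH] //; rewrite ruin_probS /= IH; ring. Qed.

Lemma nondecreasing_ruin_prob st :
  nondecreasing_seq (fun t => ruin_prob t st).
Proof.
apply/nondecreasing_seqP => t; elim: t st => [|t IH] st.
  case: st => [x|y [|c]]; last by case/andP: (ruin_prob_itv 1 (Below y c.+1)).
    by case/andP: (ruin_prob_itv 1 (Above x)).
  by rewrite !ruin_prob_ruined.
rewrite ruin_probS [leRHS]ruin_probS.
by rewrite lerD// ler_wpM2l ?IH// subr_ge0.
Qed.

Definition ruin_prob_lim st : R := lim (ruin_prob t st @[t --> \oo]).

Local Notation L := ruin_prob_lim.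

Lemma ruin_prob_cvg st : ruin_prob t st @[t --> \oo] --> L st.
Proof.
apply: nondecreasing_is_cvgn; first exact: nondecreasing_ruin_prob.
by exists 1 => _ [t _ <-]; have /andP[] := ruin_prob_itv t st.
Qed.

Lemma ruin_prob_limE st :
  L st = b * L (move r st true) + (1 - b) * L (move r st false).
Proof.
have := @ruin_prob_cvg st; rewrite -(cvg_shiftS (fun t => ruin_prob t st)).
move=> /(cvg_lim (@Rhausdorff R)) <-; apply: cvg_lim => //.
by apply: cvgD; apply: cvgMl_tmp; exact: ruin_prob_cvg.
Qed.

Lemma ruin_prob_lim_ruined y : L (Below y 0) = 1.
Proof.
apply: cvg_lim => //; under eq_fun do rewrite ruin_prob_ruined.
exact: cvg_cst.
Qed.

(** Either the walk climbs back to 0 before the clock runs out and restarts there, or ruin is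
    certain; both sides satisfy the same one-step recurrence. *)
Lemma ruin_prob_lim_below c y :
  L (Below y c) =
    1 - hit_within b c y.+1 + hit_within b c y.+1 * L (Above 0).
Proof.
elim: c y => [|c IH] y.
  by rewrite ruin_prob_lim_ruined /hit_within big_ord_recl big_ord0 /=; ring.
rewrite ruin_prob_limE hit_withinS; case: y => [|y] /=.
  by rewrite IH hit_within0; ring.
by rewrite !IH; ring.
Qed.

Hypothesis b_gt : 1 / 2 < b.

Local Notation rho := ((1 - b) / b).

Let b_gt0 : 0 < b.
Proof. by move: b_gt; lra. Qed.

Let rho_itv : 0 <= rho < 1.
Proof. by rewrite divr_ge0 ?subr_ge0//= ltr_pdivrMr //; move: b_gt; lra. Qed.

Let b_rho : b * rho = 1 - b.
Proof. by rewrite mulrC divfK ?gt_eqF. Qed.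

(* [rho ^ (x + 1)] is a supermartingale dominating ruin. *)
Lemma ruin_prob_le t x : ruin_prob t (Above x) <= rho ^+ x.+1.
Proof.
have rX n : 0 <= rho ^+ n by rewrite exprn_ge0//; case/andP: rho_itv.
elim: t x => [|t IH] x; first exact: rX.
have -> : rho ^+ x.+1 = b * rho ^+ x.+2 + (1 - b) * rho ^+ x.
  have e1 : b * rho ^+ x.+2 = (1 - b) * rho ^+ x.+1 by rewrite exprS mulrA b_rho.
  have e2 : (1 - b) * rho ^+ x = b * rho ^+ x.+1 by rewrite exprS mulrA b_rho.
  by rewrite e1 e2 -mulrDl subrK mul1r.
rewrite ruin_probS lerD ?ler_wpM2l ?subr_ge0//; first exact: IH.
(* A loss at 0 leads to [Below 0 r], where the bound required is rho^0 = 1. *)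
case: x => [|x]; last exact: IH.
by rewrite expr0; have /andP[] := ruin_prob_itv t (Below 0 r).
Qed.

(* The harmonic function [L] has constant flux [b * L (x + 1) - (1 - b) * L x],
   which vanishes because [L] tends to 0 at infinity. *)
Lemma ruin_prob_lim_above u : L (Above u) = rho ^+ u.+1 * L (Below 0 r).
Proof.
(* Indices are shifted by one: [a 0] belongs to a fresh entrance at -1, so the harmonic equation
   also covers position 0. *)
pose a u := if u is x.+1 then L (Above x) else L (Below 0 r).
have aS x : a x.+1 = b * a x.+2 + (1 - b) * a x.
  by rewrite /a ruin_prob_limE; case: x.
have flux x : b * a x.+1 - (1 - b) * a x = b * a 1%N - (1 - b) * a 0%N.
  by elim: x => // x <-; have := aS x; lra.
have a_cvg : a x @[x --> \oo] --> 0.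
  rewrite -cvg_shiftS;
    apply: (@squeeze_cvgr _ _ _ _ (fun=> 0) (fun x => rho ^+ x.+1)).
  - near=> x; apply/andP; split.
      apply: limr_ge; first exact: ruin_prob_cvg.
      by near=> t; case/andP: (ruin_prob_itv t (Above x)).
    apply: limr_le; first exact: ruin_prob_cvg.
    by near=> t; exact: ruin_prob_le.
  - exact: cvg_cst.
  - rewrite (cvg_shiftS (fun x => rho ^+ x)); apply: cvg_expr.
    by case/andP: rho_itv => r0 r1; rewrite ger0_norm.
have flux0 : b * a 1%N - (1 - b) * a 0%N = 0.
  have : b * a x.+1 - (1 - b) * a x @[x --> \oo] --> b * 0 - (1 - b) * 0.
    by apply: cvgB; apply: cvgMl_tmp => //; rewrite (cvg_shiftS a).
  under eq_fun do rewrite flux.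
  rewrite !mulr0 subrr => h; apply: (cvg_unique _ (cvg_cst _) h).
  exact: Rhausdorff.
suff aE x : a x = rho ^+ x * a 0%N by exact: (aE u.+1).
elim: x => [|x IH]; first by rewrite expr0 mul1r.
rewrite exprS -mulrA -IH; apply: (mulfI (x := b)); first by rewrite gt_eqF.
by rewrite mulrA b_rho; apply/eqP; rewrite -subr_eq0 flux flux0.
Unshelve. all: by end_near. Qed.

(** The two preceding relations close up: the value x at 0 solves x = rho (1 - F + F x), and 1 - rho
    F > 0 since rho < 1 and F <= 1. *)
Lemma ruin_prob_lim_aboveE u (F := hit_within b r 1) :
  L (Above u) = (1 - F) / (1 - rho * F) * rho ^+ u.+1.
Proof.
have F01 : 0 <= F <= 1 by exact: hit_within_itv.
have rF : 1 - rho * F != 0.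
  by rewrite gt_eqF// subr_gt0; case/andP: rho_itv => ? ?; nra.
have := ruin_prob_lim_above 0; rewrite ruin_prob_lim_below -/F expr1 => L0.
rewrite ruin_prob_lim_above ruin_prob_lim_below -/F mulrC; congr (_ * _).
have -> : L (Above 0) = rho * (1 - F) / (1 - rho * F).
  by apply: (mulIf rF); rewrite mulfVK// mulrBr mulr1 {1}L0; ring.
by move: rF; move: ((1 - b) / b) F {F01 L0} => x F rF; field.
Qed.

End RuinProbability.

(** * From the claims to coin tosses *)

Section GamblerClaims.
Context (d : measure_display) (T : measurableType d) (R : realType).
Context (P : probability T R) (b : R) (Y : nat -> {RV P >-> nat}).
Hypothesis hY : gambler_claims b Y.

Definition claim (win : bool) : nat := if win then 2%N else 0%N.

Definition cylinder (s : seq bool) : set T :=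
  [set w | forall i, (i < size s)%N -> Y i w = nth 0%N (map claim s) i].

Lemma measurable_cylinder s : measurable (cylinder s).
Proof.
by rewrite /cylinder -(size_map claim); exact: measurable_claims.
Qed.

Lemma cylinder_rcons s e :
  cylinder (rcons s e) = cylinder s `&` Y (size s) @^-1` [set claim e].
Proof.
apply/seteqP; split=> w /=.
  rewrite /cylinder /= size_rcons map_rcons => H; split.
    by move=> i si; rewrite H ?nth_rcons ?size_map ?si// ltnW.
  by rewrite H// nth_rcons size_map ltnn eqxx.
rewrite /cylinder /= size_rcons map_rcons => -[H He] i.
rewrite ltnS leq_eqVlt nth_rcons size_map => /predU1P[->|si].
  by rewrite ltnn eqxx.
by rewrite si H.
Qed.

Lemma probability_cylinder s :
  P (cylinder s) = (\prod_(e <- s) (if e then b else 1 - b))%:E.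
Proof.
have [indep pmf] := hY.
have -> : cylinder s =
    \bigcap_(j in [set` iota 0 (size s)]) (Y j @^-1` [set nth 0%N (map claim s) j]).
  apply/seteqP; split=> w H i /=.
    by rewrite mem_iota => /andP[_ si]; exact: H.
  by move=> si; apply: H; rewrite /= mem_iota.
rewrite indep ?iota_uniq// -prodEFin [RHS](big_nth false) /index_iota subn0.
rewrite big_seq [RHS]big_seq; apply: eq_bigr => i.
rewrite mem_iota => /andP[_ si].
by rewrite pmf (nth_map false)// /claim /gambler_pmf; case: (nth _ _ _).
Qed.

Lemma probability_binary i :
  P (~` (Y i @^-1` [set 0%N] `|` Y i @^-1` [set 2%N])) = 0.
Proof.
have [_ pmf] := hY.
have mY k : measurable (Y i @^-1` [set k]).
  by rewrite -[X in measurable X]setTI; exact: measurable_funP.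
rewrite probability_setC; last exact: measurableU.
suff -> : P (Y i @^-1` [set 0%N] `|` Y i @^-1` [set 2%N]) = 1%E by rewrite subee.
rewrite measureU //; last by apply/seteqP; split=> w //= [->].
transitivity ((gambler_pmf b 0)%:E + (gambler_pmf b 2)%:E)%E.
  by congr (_ + _)%E; exact: pmf.
by rewrite -EFinD /gambler_pmf /= subrK.
Qed.

(** Claims other than 0 and 2 form a null set. *)
Lemma probability_split (i : nat) (A : set T) : measurable A ->
  P A = (P (A `&` Y i @^-1` [set 2%N]) + P (A `&` Y i @^-1` [set 0%N]))%E.
Proof.
move=> mA.
have mY k : measurable (Y i @^-1` [set k]).
  by rewrite -[X in measurable X]setTI; exact: measurable_funP.
rewrite (measureDI P mA (mY 2%N)) addeC; congr (_ + _)%E.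
rewrite (measureDI P (measurableD mA (mY 2%N)) (mY 0%N)).
rewrite (subset_measure0 _ _ _ (probability_binary i)) ?add0e.
- congr (P _); apply/seteqP; split=> w /=; first by move=> [[]].
  by move=> [Aw Yw]; split=> //; split=> //; rewrite Yw.
- by apply: measurableD => //; exact: measurableD.
- by apply: measurableC; exact: measurableU.
- by move=> w /= [[_ n2] n0] [].
Qed.

(** Transfer to tosses: [E] has to agree with [Q] only where the first [n] claims are 0 or 2, which
    is almost everywhere. *)
Lemma probability_coin_prob (n : nat) (Q : seq bool -> bool) (E : set T) :
  measurable E ->
  (forall w, (forall i, (i < n)%N -> Y i w = 0%N \/ Y i w = 2%N) ->
    (E w <-> Q [seq Y i w == 2%N | i <- iota 0 n])) ->
  P E = (coin_prob b n Q)%:E.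
Proof.
move=> mE EQ.
(* Generalized to a fixed prefix [s] of outcomes, with [Q'] reading the [m] remaining ones. *)
suff H m (s : seq bool) (Q' : seq bool -> bool) :
    (forall w, cylinder s w ->
      (forall i, (i < m)%N ->
        Y (size s + i) w = 0%N \/ Y (size s + i) w = 2%N) ->
      (E w <-> Q' [seq Y i w == 2%N | i <- iota (size s) m])) ->
    P (E `&` cylinder s) =
      (\prod_(e <- s) (if e then b else 1 - b) * coin_prob b m Q')%:E.
  have := H n [::] Q; rewrite big_nil mul1r => <- //.
    by congr (P _); apply/seteqP; split=> w //= [].
  by move=> w _; exact: EQ.
elim: m s Q' => [|m IH] s Q' EQ' /=.
  have [q|nq] := boolP (Q' [::]).
    rewrite mulr1 -probability_cylinder; congr (P _).
    by apply/seteqP; split=> w /= => [[]|Cw] //; split=> //; apply/EQ'.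
  rewrite mulr0 (_ : _ `&` _ = set0) ?measure0//.
  apply/seteqP; split=> w // [/= Ew Cw].
  by apply: (negP nq); apply/(EQ' w Cw).
rewrite (probability_split (size s)); last first.
  by apply: measurableI => //; exact: measurable_cylinder.
have step e : P (E `&` cylinder s `&` Y (size s) @^-1` [set claim e]) =
    (\prod_(e <- s) (if e then b else 1 - b) * ((if e then b else 1 - b) *
      coin_prob b m (fun t => Q' (e :: t))))%:E.
  rewrite -setIA -cylinder_rcons (IH _ (fun t => Q' (e :: t))).
    by rewrite -cats1 big_cat big_seq1 mulrA.
  move=> w; rewrite cylinder_rcons => -[Cw Yw] bin.
  have -> : e :: [seq Y i w == 2%N | i <- iota (size (rcons s e)) m] =
      [seq Y i w == 2%N | i <- iota (size s) m.+1].
    by rewrite size_rcons /= Yw; case: (e).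
  apply: EQ' => // -[|i] im.
    by rewrite addn0 Yw; case: (e); [right|left].
  by have := bin i im; rewrite size_rcons addSnnS.
by rewrite (step true) (step false) -EFinD mulrDr.
Qed.

Lemma measurable_partial_sum n k : measurable [set w | partial_sum Y n w = k].
Proof.
elim: n k => [|n IH] k.
  have [<-|/eqP k0] := eqVneq 0%N k.
    by rewrite (_ : [set _ | _] = setT)//; apply/seteqP; split=> w //= _;
      rewrite /partial_sum big_ord0.
  rewrite (_ : [set _ | _] = set0)//; apply/seteqP; split=> w //=.
  by rewrite /partial_sum big_ord0.
rewrite (_ : [set _ | _] = \bigcup_j ([set w | partial_sum Y n w = j] `&`
    Y n @^-1` [set y | (j + y)%N = k])).
  apply: bigcupT_measurable => j; apply: measurableI => //.
  by rewrite -[X in measurable X]setTI; exact: measurable_funP.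
apply/seteqP; split=> w /=; rewrite /partial_sum big_ord_recr /=.
  by move=> H; eexists.
by move=> [j _ [/= ->]].
Qed.

Lemma conv_pmfE n k : conv_pmf Y n k = win_pmf b n k.
Proof.
rewrite /conv_pmf (@probability_coin_prob n (fun s => (count id s).*2 == k)).
- by rewrite /= coin_prob_wins.
- exact: measurable_partial_sum.
move=> w bin /=; have -> : partial_sum Y n w =
    (count id [seq Y i w == 2%N | i <- iota 0 n]).*2.
  rewrite /partial_sum -(big_mkord xpredT (fun i => Y i w)) /index_iota subn0.
  have : all (fun i => i < n)%N (iota 0 n).
    by apply/allP => i; rewrite mem_iota.
  elim: (iota 0 n) => [|i t IH] /=; first by rewrite big_nil.
  move=> /andP[lt_in tn]; rewrite big_cons IH//.
  by case: (bin i lt_in) => ->; rewrite ?add1n ?doubleS.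
by split => /eqP.
Qed.

(** The term at time 0 of [hit_within] vanishes; the others match [C1] termwise. *)
Lemma C1E r : b * C1 Y r = hit_within b r 1.
Proof.
rewrite /hit_within big_ord_recl add0r /C1.
rewrite big_add1 [in X in _ - X]big_add1 /= !big_mkord -sumrB mulr_sumr.
apply: eq_bigr => i _; rewrite -[RHS]/(hit b i.+1 1) hit1_win_pmf// conv_pmfE /=.
by congr (_ * (_ - _)); apply: eq_bigr => j _; rewrite !conv_pmfE.
Qed.

End GamblerClaims.

(** * Parisian ruin along a fixed path *)

Section ParisianPath.
Context (d : measure_display) (T : measurableType d) (R : realType).
Context (P : probability T R) (Y : nat -> {RV P >-> nat}) (r u : nat) (w : T).
Hypothesis r_gt0 : (0 < r)%N.

Local Notation X n := (risk_process Y u n w).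
Local Notation entrances n := (entrance_times Y u n w).

(** An attained maximum, replacing the supremum in the extended reals. *)
Definition latest_entrance (n s : nat) : Prop :=
  entrances n s /\ forall s', entrances n s' -> (s' <= s)%N.

Definition parisian_at (n : nat) : Prop :=
  X n < 0 /\ exists2 s, latest_entrance n s & n = (s + r)%N.

Lemma latest_entrance_sup n s :
  latest_entrance n s -> last_entrance Y u n w = (s%:R)%:E.
Proof.
move=> [ent smax]; apply/eqP; rewrite eq_le; apply/andP; split.
  by apply: ge_ereal_sup => _ [s' /smax s's <-]; rewrite lee_fin ler_nat.
by apply: ereal_sup_ubound; exists s.
Qed.

Lemma latest_entrance_ex n : entrances n !=set0 -> exists s, latest_entrance n s.
Proof.
move=> [s0 ent0].
have ex : exists s, `[< entrances n s >] by exists s0; apply/asboolP.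
have bd s : `[< entrances n s >] -> (s <= n)%N by move=> /asboolP[] /andP[].
case: (ex_maxnP ex bd) => s /asboolP ent smax; exists s; split=> // s' ent'.
by apply: smax; apply/asboolP.
Qed.

Lemma parisian_atP n :
  ((n%:R : R)%:E - last_entrance Y u n w)%E = (r%:R : R)%:E /\ X n < 0 <->
  parisian_at n.
Proof.
split=> [[nr Xn]|[Xn [s lat ns]]]; last first.
  by rewrite (latest_entrance_sup lat) -EFinB [in n%:R]ns natrD addrC addKr.
split=> //.
have [ent0|/set0P/latest_entrance_ex[s lat]] := eqVneq (entrances n) set0.
  (* Without entrances the supremum is -oo, and the difference is +oo, never [r]. *)
  by move: nr; rewrite /last_entrance ent0 image_set0 ereal_sup0.
exists s => //; move: nr; rewrite (latest_entrance_sup lat) -EFinB => -[] /eqP.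
by rewrite subr_eq -natrD eqr_nat addnC => /eqP.
Qed.

Lemma parisian_time_lt t :
  (parisian_time Y r u w < (t%:R : R)%:E)%E <->
  exists2 n, (n < t)%N & parisian_at n.
Proof.
split.
  move=> /ereal_inf_lt[_ [n /parisian_atP npar <-]].
  by rewrite lte_fin ltr_nat => nt; exists n.
move=> [n nt npar]; apply: (@le_lt_trans _ _ (n%:R)%:E); last first.
  by rewrite lte_fin ltr_nat.
by apply: ereal_inf_lbound; exists n => //; apply/parisian_atP.
Qed.

Lemma risk_process0 : X 0 = u%:Z.
Proof. by rewrite /risk_process /partial_sum big_ord0; lia. Qed.

Lemma risk_processS n : X n.+1 = X n - 1 + (Y n w)%:Z.
Proof. by rewrite /risk_process /partial_sum big_ord_recr /=; lia. Qed.

(** An entrance at [n + 1] would need position 0 at time [n]. *)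
Lemma latest_entranceS n s : latest_entrance n s -> X n < 0 ->
  latest_entrance n.+1 s.
Proof.
move=> [[/andP[s0 sn] Xs Xs'] smax] Xn; split.
  by split => //; rewrite s0 ltnW.
move=> s' [/andP[s'0 s'n] X1 X2].
have [ss'|ss'] := leqP s' n; first by apply: smax; split=> //; rewrite s'0.
have es : s' = n.+1 by lia.
by move: X2 Xn; rewrite es /= => ->.
Qed.

Lemma latest_entrance_unique n s s' :
  latest_entrance n s -> latest_entrance n s' -> s = s'.
Proof.
by move=> [e m] [e' m']; apply/eqP; rewrite eqn_leq m' // m.
Qed.

Definition unruined_upto n := forall m, (m <= n)%N -> ~ parisian_at m.

Lemma unruined_uptoS n : unruined_upto n -> ~ parisian_at n.+1 ->
  unruined_upto n.+1.
Proof. by move=> H Hn m; rewrite leq_eqVlt => /predU1P[->|/H]. Qed.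

(** Invariant tying the chain to the path: a clock value c > 0 means n + c = s + r for the latest
    entrance s. A ruined state only records that ruin has occurred. *)
Definition tracks (n : nat) (st : state) : Prop :=
  match st with
  | Above x => X n = x%:Z /\ unruined_upto n
  | Below y 0 => exists2 m, (m <= n)%N & parisian_at m
  | Below y c.+1 =>
      [/\ X n = - y.+1%:Z, unruined_upto n &
        exists2 s, latest_entrance n s & (n + c.+1 = s + r)%N]
  end.

Lemma tracksS n st : Y n w = 0%N \/ Y n w = 2%N ->
  tracks n st -> tracks n.+1 (move r st (Y n w == 2%N)).
Proof.
move=> Y02.
have XS : X n.+1 = if Y n w == 2%N then X n + 1 else X n - 1.
  by rewrite risk_processS; case: Y02 => -> /=; lia.
case: st => [x [Xn unr]|y [|c]] /=; last 2 first.
- by move=> [m mn par]; exists m => //; exact: leqW.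
- move=> [Xn unr [s lat nc]].
  have latS : latest_entrance n.+1 s by apply: latest_entranceS => //; rewrite Xn.
  (* Ruin at [n + 1] means n + 1 = s + r, so the clock has just run out. *)
  have parS : parisian_at n.+1 -> c = 0%N.
    move=> [_ [s' lat' ns']].
    have := latest_entrance_unique latS lat'; lia.
  case: eqP XS => [_|_] XS.
    case: y Xn => [|y] Xn /=.
      split; first by rewrite XS Xn.
      apply: unruined_uptoS => // -[X0 _]; move: X0; rewrite XS Xn; lia.
    case: c nc parS => [|c] nc parS /=.
      exists n.+1 => //; split; first by rewrite XS Xn; lia.
      by exists s => //; lia.
    split; first by rewrite XS Xn; lia.
      by apply: unruined_uptoS => // /parS.
    by exists s => //; lia.
  case: c nc parS => [|c] nc parS /=.
    exists n.+1 => //; split; first by rewrite XS Xn; lia.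
    by exists s => //; lia.
  split; first by rewrite XS Xn; lia.
    by apply: unruined_uptoS => // /parS.
  by exists s => //; lia.
case: eqP XS => [_|_] XS /=.
  split; first by rewrite XS Xn; lia.
  by apply: unruined_uptoS => // -[X0 _]; move: X0; rewrite XS Xn; lia.
case: x Xn => [|x] Xn /=.
  have lat : latest_entrance n.+1 n.+1.
    by split=> [|s' [] /andP[]//]; split; rewrite ?ltnSn//= XS Xn.
  (* The entrance is its own latest entrance, so ruin at this very step would force r = 0. *)
  case: r r_gt0 => // r' _; split; first by rewrite XS Xn.
    apply: unruined_uptoS => // -[_ [s' lat' ns']].
    have := latest_entrance_unique lat lat'; lia.
  by exists n.+1 => //; lia.
split; first by rewrite XS Xn; lia.
by apply: unruined_uptoS => // -[X0 _]; move: X0; rewrite XS Xn; lia.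
Qed.

Lemma tracks_foldl n : (forall i, (i < n)%N -> Y i w = 0%N \/ Y i w = 2%N) ->
  tracks n (foldl (move r) (Above u) [seq Y i w == 2%N | i <- iota 0 n]).
Proof.
elim: n => [_|n IH bin].
  split; first exact: risk_process0.
  move=> m; rewrite leqn0 => /eqP -> [X0 _]; move: X0; rewrite risk_process0; lia.
rewrite -addn1 iotaD map_cat foldl_cat /= add0n addn1; apply: tracksS.
  exact: bin.
by apply: IH => i lt_in; apply: bin; exact: leqW.
Qed.

Lemma tracks_ruined n st : tracks n st ->
  ruined st <-> exists2 m, (m <= n)%N & parisian_at m.
Proof.
by case: st => [x [_ unr]|y [|c] //= [_ unr _]]; split=> // -[m /unr].
Qed.

(** The strict bound [t + 1] leaves the times up to [t], which the first [t] claims decide. *)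
Lemma parisian_time_ruined t :
  (forall i, (i < t)%N -> Y i w = 0%N \/ Y i w = 2%N) ->
  (parisian_time Y r u w < (t.+1%:R : R)%:E)%E <->
  ruined (foldl (move r) (Above u) [seq Y i w == 2%N | i <- iota 0 t]).
Proof.
move=> bin; apply: (iff_trans (parisian_time_lt _)).
by apply: iff_sym; exact: tracks_ruined (tracks_foldl bin).
Qed.

End ParisianPath.

Theorem proposition2 (d : measure_display) (T : measurableType d)
    (R : realType) (P : probability T R) (b : R) (Y : nat -> {RV P >-> nat})
    (r : nat) (hY : gambler_claims b Y) (hb0 : 0 <= b) (hb1 : b <= 1)
    (hb : 1 / 2 < b) (hr : (1 <= r)%N) (u : nat) :
  parisian_ruin_prob Y r u =
    ((1 - b * C1 Y r) / (1 - (1 - b) * C1 Y r) * ((1 - b) / b) ^+ u.+1)%:E.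
Proof.
have beforeE t : parisian_ruin_before Y r u t.+1 = (ruin_prob b r t (Above u))%:E.
  apply: (probability_coin_prob hY); first exact: measurable_before.
  by move=> w; exact: parisian_time_ruined.
have b0 : b != 0 by rewrite gt_eqF//; lra.
(* With F = b C1, the denominator becomes 1 - rho F. *)
have -> : (1 - b) * C1 Y r = (1 - b) / b * hit_within b r 1.
  by rewrite -(C1E hY); field.
rewrite (C1E hY) -ruin_prob_lim_aboveE//.
apply: cvg_lim => //.
(* The shift matches ruin before [t + 1] with [t] tosses of the chain. *)
rewrite -cvg_shiftS; under eq_fun do rewrite beforeE.
by apply: cvg_EFin; [near=> t|exact: ruin_prob_cvg].
Unshelve. all: by end_near. Qed.
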